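(* Let $n\ge 1$ be an integer and write $n=3k+r$ with $k=\lfloor n/3\rfloor$ and $r\in\{0,1,2\}$. Then the optimal rubbling number of the ladder $P_n\square P_2$ is $$\varrho_{\mathrm{opt}}(P_n\square P_2)=\begin{cases}1+2k & \text{if } r=0,\\ 2+2k & \text{if } r=1,\\ 2+2k & \text{if } r=2.\end{cases}$$
   Context: $P_n$ denotes the path on $n$ vertices, $C_n$ the cycle on $n$ vertices, and $G\square H$ the Cartesian product of graphs; $P_n\square P_2$ is called a ladder. A pebble distribution on a graph $G$ is a function $p:V(G)\to\mathbb{Z}_{\ge 0}$; its size is $\sum_v p(v)$. A pebbling move along an edge $\{v,u\}$ removes two pebbles from $v$ and adds one pebble at $u$. A strict rubbling move $(v,w\to u)$, where $v\ne w$ are both neighbours of $u$, removes one pebble from each of $v$ and $w$ and adds one pebble at $u$. A rubbling move is either of these. A sequence of rubbling moves is executable from $p$ if the number of pebbles at every vertex stays nonnegative after each move. A vertex $v$ is reachable from $p$ if some executable sequence ends with at least one pebble on $v$; $p$ is solvable if every vertex is reachable. The optimal rubbling number $\varrho_{\mathrm{opt}}(G)$ is the minimum size of a solvable distribution on $G$. *)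

(* Defs.v *)
From HB Require Import structures.
From mathcomp Require Import all_boot.
From mathcomp Require Import boolp.
Set Implicit Arguments.
Unset Strict Implicit.
Unset Printing Implicit Defensive.

Record sgraph := SGraph {
  vertex :> finType;
  adj : rel vertex;
  adj_sym : symmetric adj;
  adj_irrefl : irreflexive adj
}.

Section Path.
Variable n : nat.

Definition path_adj : rel 'I_n := fun i j => (i.+1 == j) || (j.+1 == i).

Lemma path_adj_sym : symmetric path_adj.
Proof. by move=> i j; rewrite /path_adj orbC. Qed.

Lemma path_adj_irrefl : irreflexive path_adj.
Proof. by move=> i; rewrite /path_adj orbb eqn_leq ltnn. Qed.

Definition path_graph : sgraph := SGraph path_adj_sym path_adj_irrefl.
End Path.

Section CartesianProduct.
Variables G H : sgraph.

Definition cart_adj : rel (G * H)%type := fun x y =>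
  ((x.1 == y.1) && adj x.2 y.2) || ((x.2 == y.2) && adj x.1 y.1).

Lemma cart_adj_sym : symmetric cart_adj.
Proof.
by move=> x y; rewrite /cart_adj (eq_sym x.1) (eq_sym x.2)
  (adj_sym x.1) (adj_sym x.2).
Qed.

Lemma cart_adj_irrefl : irreflexive cart_adj.
Proof. by move=> x; rewrite /cart_adj !adj_irrefl !andbF. Qed.

Definition cartesian_product : sgraph := SGraph cart_adj_sym cart_adj_irrefl.
End CartesianProduct.

Definition ladder (n : nat) : sgraph :=
  cartesian_product (path_graph n) (path_graph 2).

Section Rubbling.
Variable G : sgraph.

Definition distribution := {ffun G -> nat}.

Definition dist_size (p : distribution) : nat := \sum_(v : G) p v.

Inductive rubbling_move :=
  | Pebbling (v u : G)
  | Strict (v w u : G).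

Definition legal (m : rubbling_move) : bool :=
  match m with
  | Pebbling v u => adj v u
  | Strict v w u => [&& v != w, adj v u & adj w u]
  end.

Definition removed (m : rubbling_move) (x : G) : nat :=
  match m with
  | Pebbling v _ => 2 * (x == v)
  | Strict v w _ => (x == v) + (x == w)
  end.

Definition added (m : rubbling_move) (x : G) : nat :=
  match m with
  | Pebbling _ u => x == u
  | Strict _ _ u => x == u
  end.

(* The subtraction is truncated; [executable] excludes the moves for which
   this would matter. *)
Definition apply_move (p : distribution) (m : rubbling_move) : distribution :=
  [ffun x => p x - removed m x + added m x].

(* In a legal move no pebble is added where one is removed, so the counts stay
   nonnegative exactly when the removed pebbles are present beforehand. *)
Fixpoint executable (p : distribution) (s : seq rubbling_move) : bool :=
  if s is m :: s' then
    [&& legal m, [forall x, removed m x <= p x]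
      & executable (apply_move p m) s']
  else true.

Definition reachable (p : distribution) (v : G) : Prop :=
  exists2 s : seq rubbling_move, executable p s & 0 < foldl apply_move p s v.

Definition solvable (p : distribution) : Prop := forall v : G, reachable p v.

Definition solvable_size (m : nat) : Prop :=
  exists2 p : distribution, solvable p & dist_size p = m.

Lemma solvable_size_ex : exists m, `[< solvable_size m >].
Proof.
exists (dist_size [ffun=> 1]); apply/asboolP; exists [ffun=> 1] => // v.
by exists [::]; rewrite //= ffunE.
Qed.

Definition optimal_rubbling_number : nat := ex_minn solvable_size_ex.
End Rubbling.

(* Main.v *)
(** Call a column's [p] the number of its pebbles, and let [a], [b] be the numbers
    of pebbles that the columns on its left and on its right could deliver to it
    if each column were a single vertex; these obey [a' = p + a / 2] (rounded
    down). Potentials that no rubbling move increases turn reachability into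
    local conditions: a column with [p = 1] needs [a + b >= 1], and one with
    [p = 0] needs [a + b >= 2], and more if two pebbles from one side alone
    cannot reach both of its vertices. A credit for incoming pebbles then satisfies [2 + credit out <= 3 p + credit in] at every column. Summing
    over the columns leaves a credit of at least 1 at either end, hence
    [2 n + 2 <= 3 |p|]. Equality up to rounding is attained by repeating columns
    with one pebble in row 0, one pebble in row 1, and none. *)
Require Import Defs.
From HB Require Import structures.
From mathcomp Require Import all_boot.
From mathcomp Require Import zify boolp.

(** * One-sided delivery along a path of columns *)

(** [acc c k] counts pebbles gathered in column [k.-1] from the columns below [k]; the halving for
    the step into column [k] comes only at the next index. *)
Fixpoint acc (c : nat -> nat) (k : nat) : nat :=
  if k is k'.+1 then c k' + (acc c k')./2 else 0.

Lemma eq_acc (c c' : nat -> nat) (k : nat) :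
  (forall x, x < k -> c x = c' x) -> acc c k = acc c' k.
Proof.
elim: k => [//|k IH] H /=; rewrite H // IH // => x xk; apply: H; exact: ltnW.
Qed.

(* A move takes one pebble from each of the columns [s1], [s2] and puts one on
   [t]; only when it enters the first [k] columns from column [k] can it raise
   what they deliver, and then by at most 1. *)
Lemma acc_move (c c' : nat -> nat) (s1 s2 t k : nat) :
  s1 <= t.+1 -> t <= s1.+1 -> s2 <= t.+1 -> t <= s2.+1 ->
  (forall x, x < k -> c' x + (s1 == x) + (s2 == x) = c x + (t == x)) ->
  if k <= t then acc c' k + (s1.+1 == k) + (s2.+1 == k) = acc c k
  else acc c' k <= acc c k + ((s1 == k) || (s2 == k)).
Proof.
move=> h1 h2 h3 h4; elim: k => [|k IH] H; first by rewrite leq0n /= addn0.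
have {}IH := IH (fun x xk => H x (ltnW xk)); have {H} := H k (leqnn _).
rewrite [acc c' _.+1]/= [acc c _.+1]/= !eqSS; move: IH.
move: (acc c' k) (acc c k) (c' k) (c k) => a' a p' p.
case: (ltngtP k t) => kt; do !case: eqP => ? //=; lia.
Qed.

(** * Configurations and moves in column coordinates *)

(* [N j e] is the number of pebbles in column [j], row [e]; only [j < n] and
   [e < 2] matter. *)
Definition config := nat -> nat -> nat.

Definition ladj (j e j' e' : nat) : Prop :=
  (j = j' /\ e <> e') \/ (e = e' /\ (j = j'.+1 \/ j' = j.+1)).

(** Equal sources give a pebbling move. As a source is never the target, the subtraction-free
    equation itself forces the removed pebbles to be present. *)
Record lmove (n : nat) (N N' : config) (j1 e1 j2 e2 j e : nat) : Prop := LMove {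
  lmove_col1 : j1 < n; lmove_row1 : e1 < 2;
  lmove_col2 : j2 < n; lmove_row2 : e2 < 2;
  lmove_col : j < n; lmove_row : e < 2;
  lmove_adj1 : ladj j1 e1 j e; lmove_adj2 : ladj j2 e2 j e;
  lmove_eq : forall x d, x < n -> d < 2 ->
    N' x d + ((j1 == x) && (e1 == d)) + ((j2 == x) && (e2 == d))
    = N x d + ((j == x) && (e == d)) }.

Inductive lreach (n : nat) (N : config) : config -> Prop :=
  | LReach0 : lreach n N N
  | LReachS N1 N2 j1 e1 j2 e2 j e :
      lmove n N N1 j1 e1 j2 e2 j e -> lreach n N1 N2 -> lreach n N N2.

Definition lsolvable (n : nat) (N : config) : Prop :=
  forall j e, j < n -> e < 2 -> exists2 N', lreach n N N' & 0 < N' j e.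

Definition mirror (n : nat) (N : config) : config := fun j => N (n.-1 - j).

Definition col (N : config) (j : nat) : nat := N j 0 + N j 1.

Definition from_left (N : config) (i : nat) : nat := acc (col N) i.
(** Going through the mirror image lets facts about the left transfer. *)
Definition from_right (n : nat) (N : config) (i : nat) : nat :=
  from_left (mirror n N) (n.-1 - i).

Lemma lmove_mirror n N N' j1 e1 j2 e2 j e :
  lmove n N N' j1 e1 j2 e2 j e ->
  lmove n (mirror n N) (mirror n N') (n.-1 - j1) e1 (n.-1 - j2) e2 (n.-1 - j) e.
Proof.
case=> h1 h2 h3 h4 h5 h6 A1 A2 H.
split; try lia; try (by move: A1 A2; rewrite /ladj; lia).
move=> x d xn d2; have := H (n.-1 - x) d; rewrite /mirror.
have E y : y < n -> (n.-1 - y == x) = (y == n.-1 - x) by move=> ?; lia.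
by rewrite !E //; apply; lia.
Qed.

Lemma lreach_mirror n N N' :
  lreach n N N' -> lreach n (mirror n N) (mirror n N').
Proof.
elim=> [M|M M1 M2 j1 e1 j2 e2 j e /lmove_mirror S _ R]; first exact: LReach0.
exact: LReachS S R.
Qed.

Lemma lsolvable_mirror n N : lsolvable n N -> lsolvable n (mirror n N).
Proof.
move=> S j e jn e2; have [||N' R P] := S (n.-1 - j) e; try lia.
by exists (mirror n N'); first exact: lreach_mirror.
Qed.

Lemma lmove_from_left n N N' j1 e1 j2 e2 j e i :
  lmove n N N' j1 e1 j2 e2 j e -> i <= n ->
  if i <= j
  then from_left N' i + (j1.+1 == i) + (j2.+1 == i) = from_left N i
  else from_left N' i <= from_left N i + ((j1 == i) || (j2 == i)).
Proof.
case=> h1 h2 h3 h4 h5 h6 A1 A2 H lin.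
apply: acc_move; try (by move: A1 A2; rewrite /ladj; lia).
move=> x xi; have xn := leq_trans xi lin.
move: (H x 0 xn isT) (H x 1 xn isT); rewrite /col; clear -h2 h4 h6.
case: e1 h2 => [|[|//]] _; case: e2 h4 => [|[|//]] _; case: e h6 => [|[|//]] _;
  rewrite ?andbT ?andbF; lia.
Qed.

Lemma lmove_from_right n N N' j1 e1 j2 e2 j e i :
  lmove n N N' j1 e1 j2 e2 j e -> i < n ->
  if j <= i
  then from_right n N' i + (j1 == i.+1) + (j2 == i.+1) = from_right n N i
  else from_right n N' i <= from_right n N i + ((j1 == i) || (j2 == i)).
Proof.
move=> S lin; have S' := lmove_mirror _ _ _ _ _ _ _ _ _ S.
have := lmove_from_left _ _ _ _ _ _ _ _ _ (n.-1 - i) S'.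
case: S => h1 h2 h3 h4 h5 h6 _ _ _; rewrite -!/(from_right _ _ _).
have E1 y : y < n -> ((n.-1 - y).+1 == n.-1 - i) = (y == i.+1) by move=> ?; lia.
have E2 y : y < n -> (n.-1 - y == n.-1 - i) = (y == i) by move=> ?; lia.
have E3 : (n.-1 - i <= n.-1 - j) = (j <= i) by lia.
by rewrite !E1 // !E2 // E3; apply; lia.
Qed.

(** * Potentials and local conditions *)

(* The two potentials weigh a pebble according to its use for the target, which
   is [(i, e)] in [potential1] and [(i.+1, e)] in [potential2]. *)
Definition potential1 (n i e : nat) (N : config) : nat :=
  2 * N i e + N i (1 - e) + from_left N i + from_right n N i.

Definition potential2 (n i e : nat) (N : config) : nat :=
  4 * N i.+1 e + 2 * N i.+1 (1 - e) + 2 * N i e + N i (1 - e)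
  + from_left N i + 2 * from_right n N i.+1.

(** Each neighbour of a vertex of column [i] weighs at least half as much as that vertex. A pebble
    leaving column [i] loses at least 1, while the side it enters gains at most 1. *)
Lemma potential1_lmove n i d N N' j1 e1 j2 e2 j e :
  i < n -> d < 2 -> lmove n N N' j1 e1 j2 e2 j e ->
  potential1 n i d N' <= potential1 n i d N.
Proof.
move=> lin d2 S.
have HL := lmove_from_left _ _ _ _ _ _ _ _ _ i S (ltnW lin).
have HR := lmove_from_right _ _ _ _ _ _ _ _ _ i S lin.
case: S => h1 h2 h3 h4 h5 h6 A1 A2 H.
have H1 := H i d lin d2; have H2 := H i (1 - d) lin (leq_subr d 1).
rewrite /potential1; move: A1 A2 HL HR H1 H2; clear -h2 h4 h6 d2.
move: (N i d) (N' i d) (N i _) (N' i _) => x x' y y'.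
move: (from_left _ _) (from_left _ _) (from_right _ _ _) (from_right _ _ _).
move=> a' a b' b A1 A2.
have {A1} A1 : e1 = 1 - e /\ j1 = j \/ e1 = e /\ (j1 = j.+1 \/ j = j1.+1).
  by move: A1; rewrite /ladj; lia.
have {A2} A2 : e2 = 1 - e /\ j2 = j \/ e2 = e /\ (j2 = j.+1 \/ j = j2.+1).
  by move: A2; rewrite /ladj; lia.
case: d d2 => [|[|//]] _; case: e h6 A1 A2 => [|[|//]] _ A1 A2;
  rewrite ?subn0 ?subnn in A1 A2 *;
case: (ltngtP j i) => ji;
 case: A1 => [[-> ->]|[-> [->|A1]]]; case: A2 => [[-> ->]|[-> [->|A2]]];
 try subst i; try subst j;
 rewrite /= ?andbT ?andbF ?eqxx ?ltnn ?leqnn; lia.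
Qed.

Lemma potential2_lmove n i d N N' j1 e1 j2 e2 j e :
  i.+1 < n -> d < 2 -> lmove n N N' j1 e1 j2 e2 j e ->
  potential2 n i d N' <= potential2 n i d N.
Proof.
move=> lin d2 S.
have HL := lmove_from_left _ _ _ _ _ _ _ _ _ i S (ltnW (ltnW lin)).
have HR := lmove_from_right _ _ _ _ _ _ _ _ _ i.+1 S lin.
case: S => h1 h2 h3 h4 h5 h6 A1 A2 H.
have H1 := H i d (ltnW lin) d2; have H2 := H i (1 - d) (ltnW lin) (leq_subr d 1).
have H3 := H i.+1 d lin d2; have H4 := H i.+1 (1 - d) lin (leq_subr d 1).
rewrite /potential2; move: A1 A2 HL HR H1 H2 H3 H4; clear -h2 h4 h6 d2.
move: (N i d) (N' i d) (N i _) (N' i _) => x x' y y'.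
move: (N i.+1 d) (N' i.+1 d) (N i.+1 _) (N' i.+1 _) => z z' w w'.
move: (from_left _ _) (from_left _ _) (from_right _ _ _) (from_right _ _ _).
move=> a' a b' b A1 A2.
have {A1} A1 : e1 = 1 - e /\ j1 = j \/ e1 = e /\ (j1 = j.+1 \/ j = j1.+1).
  by move: A1; rewrite /ladj; lia.
have {A2} A2 : e2 = 1 - e /\ j2 = j \/ e2 = e /\ (j2 = j.+1 \/ j = j2.+1).
  by move: A2; rewrite /ladj; lia.
have ji : [\/ j < i, j = i, j = i.+1 | i.+1 < j].
  case: (ltngtP j i) => [?|ij|->]; [by constructor 1| |by constructor 2].
  by case: (ltngtP j i.+1) => ?; [lia|constructor 4|constructor 3].
case: d d2 => [|[|//]] _; case: e h6 A1 A2 => [|[|//]] _ A1 A2;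
  rewrite ?subn0 ?subnn in A1 A2 *;
case: ji => ji;
 case: A1 => [[-> ->]|[-> [->|A1]]]; case: A2 => [[-> ->]|[-> [->|A2]]];
 try subst i; try subst j;
 rewrite /= ?andbT ?andbF ?eqxx ?ltnn ?leqnn; do 2?[case: ifP => ?]; lia.
Qed.

Lemma potential1_lreach n i d N N' :
  i < n -> d < 2 -> lreach n N N' -> potential1 n i d N' <= potential1 n i d N.
Proof.
move=> lin d2; elim=> // M M1 M2 j1 e1 j2 e2 j e S _ /leq_trans; apply.
exact: potential1_lmove lin d2 S.
Qed.

Lemma potential2_lreach n i d N N' :
  i.+1 < n -> d < 2 -> lreach n N N' ->
  potential2 n i d N' <= potential2 n i d N.
Proof.
move=> lin d2; elim=> // M M1 M2 j1 e1 j2 e2 j e S _ /leq_trans; apply.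
exact: potential2_lmove lin d2 S.
Qed.

Lemma lsolvable_potential1 n i d N :
  lsolvable n N -> i < n -> d < 2 -> 2 <= potential1 n i d N.
Proof.
move=> S lin d2; have [N' R P] := S i d lin d2.
by have := potential1_lreach _ _ _ _ _ lin d2 R; rewrite {1}/potential1; lia.
Qed.

(** The threshold is the weight of one pebble on the target. Unlike [potential1], this one sees the
    rows of the column preceding the target. *)
Lemma lsolvable_potential2 n i d N :
  lsolvable n N -> i.+1 < n -> d < 2 -> 4 <= potential2 n i d N.
Proof.
move=> S lin d2; have [N' R P] := S i.+1 d lin d2.
by have := potential2_lreach _ _ _ _ _ lin d2 R; rewrite {1}/potential2; lia.
Qed.

(** * Credits and the lower bound for configurations *)

(* Chosen so that [phi (a / 2) + 2 <= phi a] for [a >= 2], while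
   [2 * phi p <= 3 * p - 2] for [p >= 3]. *)
Definition phi (a : nat) : nat :=
  if a <= 1 then a else if a <= 3 then 3 else a.+1.

(* The value 2 instead of [phi 2 = 3] is for the cases where the two outgoing
   pebbles cannot on their own reach both vertices of an empty column. *)
Definition psi (p a : nat) : nat :=
  if ((p == 2) && (a == 0)) || ((p == 1) && (a == 2)) then 2
  else phi (p + a./2).

Definition credit (c : nat -> nat) (k : nat) : nat :=
  if k is k'.+1 then psi (c k') (acc c k') else 0.

Definition credit_value (a g : nat) : Prop := g = phi a \/ (a = 2 /\ g = 2).

(** In both exceptional cases of [psi], [p + a./2] equals 2. *)
Lemma creditP c k : credit_value (acc c k) (credit c k).
Proof.
case: k => [|k]; first by left.
rewrite /credit_value /= /psi; case: ifP => H; last by left.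
by right; move: H; move: (acc c k) => a; lia.
Qed.

Lemma psi_bound p a ga b gb :
  credit_value a ga -> credit_value b gb ->
  (p = 1 -> 1 <= a + b) ->
  (p = 0 -> [/\ 2 <= a + b, b = 0 -> a = 2 -> ga = 3 & a = 0 -> b = 2 -> gb = 3]) ->
  2 + psi p a + psi p b <= 3 * p + ga + gb.
Proof.
have phiP x : [\/ x <= 1 /\ phi x = x, 2 <= x <= 3 /\ phi x = 3
                | 4 <= x /\ phi x = x.+1].
  rewrite /phi; case: leqP => ?; first by constructor 1.
  by case: leqP => ?; [constructor 2|constructor 3]; split; lia.
have psiP x : psi p x = 2 /\ (p = 2 /\ x = 0 \/ p = 1 /\ x = 2) \/
    psi p x = phi (p + x./2) /\ (p = 2 -> x <> 0) /\ (p = 1 -> x <> 2).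
  rewrite /psi; case: ifP => H; [left|right]; split => //; lia.
move=> Ha Hb h1 h0; case: (posnP p) => [p0|ppos]; last first.
  (* Each side may use half of the budget [3 * p - 2]. For [p = 1] only a side with [x = 0] costs 1,
     and [h1] leaves at most one such side. *)
  have half x gx : credit_value x gx ->
     [\/ p = 1 /\ psi p x <= gx + (x == 0), p = 2 /\ psi p x <= 2 + gx
       | 3 <= p /\ 2 * psi p x + 2 <= 3 * p + 2 * gx].
    have p3 : [\/ p = 1, p = 2 | 3 <= p].
      move: ppos; case: (p) => [|[|[|q]]] // _.
      + by constructor 1.
      + by constructor 2.
      + by constructor 3.
    move=> Hg; case: p3 => p3; [constructor 1|constructor 2|constructor 3]; split=> //;
    case: Hg => [?|[? ?]]; case: (phiP x) => -[? ?];
    case: (psiP x) => -[? ?]; try lia; case: (phiP (p + x./2)) => -[? ?]; lia.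
  by case: (half a ga Ha) => -[? ?]; case: (half b gb Hb) => -[? ?]; lia.
(* An empty column must save 2 in total: a side saves 1 when nonzero, and 2 from three pebbles on or
   from two with credit 3. *)
have half x gx : credit_value x gx ->
    psi p x <= gx /\ (1 <= x -> 1 + psi p x <= gx) /\ (x = 2 -> gx = 3 -> psi p x = 1)
    /\ (3 <= x -> 2 + psi p x <= gx).
  case=> [?|[? ?]]; case: (phiP x) => -[? ?];
    case: (psiP x) => -[? ?]; try lia; case: (phiP (p + x./2)) => -[? ?]; lia.
by have := half a ga Ha; have := half b gb Hb; have := h0 p0;
  case=> ? ? ? [? [? [? ?]]] [? [? [? ?]]]; lia.
Qed.

(** With credit 2, the preceding column would have a row [d] for which [potential2] is at most 3. *)
Lemma lsolvable_empty n N i :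
  lsolvable n N -> i < n -> col N i = 0 -> from_right n N i = 0 ->
  from_left N i = 2 -> credit (col N) i = 3.
Proof.
move=> S lin; case: i lin => [//|i] lin; rewrite /from_left /= => N0 R0 A2.
rewrite {1}/psi; case: ifP => H; last by rewrite A2.
have W d := lsolvable_potential2 n i d N S lin.
move: (W 0 isT) (W 1 isT); rewrite /potential2 R0 /from_left subn0 subnn.
by move: N0 H A2; rewrite /col; move: (acc _ _) => a; lia.
Qed.

(** Summing [psi_bound] over the columns, the left credits telescope upwards and the mirrored ones
    downwards. *)
Lemma sum_col_bound n N m :
  lsolvable n N -> m <= n ->
  2 * m + credit (col N) m + credit (col (mirror n N)) n
    <= 3 * (\sum_(j < m) col N j) + credit (col (mirror n N)) (n - m).
Proof.
move=> S; elim: m => [|m IH] lmn; first by rewrite big_ord0 subn0.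
have {}IH := IH (ltnW lmn); rewrite big_ord_recr /=.
have E : n - m = (n.-1 - m).+1 by lia.
have E' : n - m.+1 = n.-1 - m by lia.
have Em : col (mirror n N) (n.-1 - m) = col N m.
  by rewrite /col /mirror; congr (N _ _ + N _ _); lia.
move: IH; rewrite E E' /= Em.
have S' := lsolvable_mirror _ _ S.
have W d := lsolvable_potential1 n m d N S lmn.
have := psi_bound (col N m) _ _ _ _ (creditP (col N) m)
  (creditP (col (mirror n N)) (n.-1 - m)).
have L := lsolvable_empty n N m S lmn.
have m' : n.-1 - m < n by lia.
have L' := lsolvable_empty n _ (n.-1 - m) S' m'.
have Er : from_right n (mirror n N) (n.-1 - m) = from_left N m.
  rewrite /from_right (_ : n.-1 - (n.-1 - m) = m); last lia.
  apply: eq_acc => x xm; rewrite /col /mirror; congr (N _ _ + N _ _); lia.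
rewrite Er Em in L'; have Ecol : col N m = N m 0 + N m 1 by [].
move: (W 0 isT) (W 1 isT) L L'; rewrite /potential1 /from_right /from_left subn0 subnn.
move=> W0 W1 L L1 B; have {}B := B _ _.
suff: 2 + psi (col N m) (acc (col N) m) +
    psi (col N m) (acc (col (mirror n N)) (n.-1 - m)) <=
    3 * col N m + credit (col N) m + credit (col (mirror n N)) (n.-1 - m) by lia.
by apply: B => [|c0]; [|split; [|exact: L|exact: L1]]; lia.
Qed.

(** Otherwise the last column is empty with at most 1 gathered before it, so [potential1] there is
    below 2. *)
Lemma credit_gt0 n N : 0 < n -> lsolvable n N -> 0 < credit (col N) n.
Proof.
move=> n0 S; have : 0 < acc (col N) n.
  case: n n0 S => [//|n] _ S.
  have W d := lsolvable_potential1 n.+1 n d N S (leqnn _).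
  move: (W 0 isT) (W 1 isT).
  rewrite /potential1 /from_right /from_left /= !subnn subn0 /=.
  have: col N n = N n 0 + N n 1 by []. lia.
case: (creditP (col N) n) => [->|[_ -> //]].
by rewrite /phi; case: ifP => // _; case: ifP.
Qed.

Lemma lsolvable_size n N :
  0 < n -> lsolvable n N -> 2 * n + 2 <= 3 * \sum_(j < n) col N j.
Proof.
move=> n0 S; have := sum_col_bound n N n S (leqnn n); rewrite subnn /=.
have := credit_gt0 n N n0 S; have := credit_gt0 n _ n0 (lsolvable_mirror _ _ S); lia.
Qed.

(** * From distributions on the ladder to configurations *)

Section Ladder.
Variable n : nat.
Implicit Types p q : distribution (ladder n).

Definition config_of p : config := fun j e =>
  \sum_(v : ladder n | (v.1 == j :> nat) && (v.2 == e :> nat)) p v.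

Lemma size_config_of p : dist_size p = \sum_(j < n) col (config_of p) j.
Proof.
rewrite /dist_size (eq_bigr (fun v => p (v.1, v.2))); last by case.
rewrite -(pair_bigA _ (fun i j => p (i, j))) /=; apply: eq_bigr => i _.
have H e : config_of p i e = \sum_(j : 'I_2 | j == e :> nat) p (i, j).
  rewrite /config_of (eq_bigr (fun v => p (v.1, v.2))); last by case.
  rewrite -(pair_big (fun x : 'I_n => x == i :> nat)
    (fun j : 'I_2 => j == e :> nat) (fun i j => p (i, j))) /=.
  by rewrite (big_pred1 i).
rewrite /col !H (big_mkcond (fun j : 'I_2 => j == 0 :> nat)).
rewrite (big_mkcond (fun j : 'I_2 => j == 1 :> nat)).
by rewrite !big_ord_recl !big_ord0 /= !addn0 add0n.
Qed.

Lemma ladder_ladj (x y : ladder n) :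
  adj x y -> ladj (val x.1) (val x.2) (val y.1) (val y.2).
Proof.
case: x y => [x1 x2] [y1 y2]; rewrite /= /cart_adj /= /path_adj /ladj.
by rewrite -!val_eqE /=; lia.
Qed.

Lemma sum_delta (P : pred (ladder n)) s : \sum_(v | P v) (v == s : nat) = P s.
Proof.
rewrite big_mkcond (bigD1 s) //= eqxx big1 ?addn0; first by case: (P s).
by move=> v /negbTE ->; case: (P v).
Qed.

Lemma move_sources p m : legal m -> [forall x, removed m x <= p x] ->
  exists s1 s2 t, [/\ adj s1 t, adj s2 t &
    forall x, apply_move p m x + (x == s1) + (x == s2) = p x + (x == t)].
Proof.
case: m => [v u|v w u] /=.
- move=> A /forallP H; exists v, v, u; split=> // x.
  by have := H x; rewrite ffunE /=; lia.
- case/and3P=> vw A B /forallP H; exists v, w, u; split=> // x.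
  by have := H x; rewrite ffunE /=; lia.
Qed.

Lemma lmove_config_of p q s1 s2 t : adj s1 t -> adj s2 t ->
  (forall x, q x + (x == s1) + (x == s2) = p x + (x == t)) ->
  lmove n (config_of p) (config_of q) (val s1.1) (val s1.2)
    (val s2.1) (val s2.2) (val t.1) (val t.2).
Proof.
move=> /ladder_ladj A1 /ladder_ladj A2 E; split; rewrite ?ltn_ord //.
move=> x d _ _; rewrite /config_of.
pose P (v : ladder n) := (v.1 == x :> nat) && (v.2 == d :> nat).
rewrite -!/(P _) -!(sum_delta P) -!big_split; exact: eq_bigr.
Qed.

Lemma lreach_config_of s p : executable p s ->
  lreach n (config_of p) (config_of (foldl (@apply_move (ladder n)) p s)).
Proof.
elim: s p => [|m s IH] p /=; first by move=> _; exact: LReach0.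
case/and3P=> L R X; have [s1 [s2 [t [A1 A2 E]]]] := move_sources _ _ L R.
exact: LReachS (lmove_config_of _ _ _ _ _ A1 A2 E) (IH _ X).
Qed.

Lemma solvable_size_ge p : 0 < n -> solvable p -> 2 * n + 2 <= 3 * dist_size p.
Proof.
move=> n0 S; rewrite size_config_of; apply: lsolvable_size => // j e jn e2.
have [s X P] := S (Ordinal jn, Ordinal e2).
exists (config_of (foldl (@apply_move (ladder n)) p s)); first exact: lreach_config_of.
rewrite /config_of (bigD1 (Ordinal jn, Ordinal e2)) /= ?eqxx //.
exact: leq_trans P (leq_addr _ _).
Qed.
End Ladder.

(** * A solvable pattern of minimum size *)

Lemma reachable_strict (G : sgraph) (p : distribution G) x y t :
  x != y -> adj x t -> adj y t -> 0 < p x -> 0 < p y -> reachable p t.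
Proof.
move=> xy xt yt px py; exists [:: Strict x y t] => /=; last first.
  by rewrite ffunE /= eqxx addn1.
rewrite xy xt yt !andbT; apply/forallP => z /=.
case: (eqVneq z x) => [->|_]; first by rewrite (negbTE xy).
by case: (eqVneq z y) => [->|_].
Qed.

Lemma reachable_strict2 (G : sgraph) (p : distribution G) x y z w t :
  x != y -> adj x z -> adj y z -> 0 < p x -> 0 < p y ->
  w != x -> w != y -> z != w -> adj z t -> adj w t -> 0 < p w ->
  reachable p t.
Proof.
move=> xy xz yz px py wx wy zw zt wt pw.
have [|||||s X R] := @reachable_strict _ (apply_move p (Strict x y z)) z w t.
- by [].
- by [].
- by [].
- by rewrite ffunE /= eqxx addn1.
- by rewrite ffunE /= (negbTE wx) (negbTE wy) subn0 addn_gt0 pw.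
exists (Strict x y z :: s) => //=; rewrite xy xz yz X !andbT.
apply/forallP => v /=.
case: (eqVneq v x) => [->|_]; first by rewrite (negbTE xy).
by case: (eqVneq v y) => [->|_].
Qed.

(** Rows are 0 and 1 only, so columns with [j %% 3 = 2] stay empty, except that the last column
    always has a pebble in row 1. *)
Definition pebbles (n j e : nat) : bool :=
  (e == j %% 3) || ((e == 1) && (j.+1 == n)).

Definition pattern (n : nat) : distribution (ladder n) :=
  [ffun v : ladder n => pebbles n v.1 v.2 : nat].

Section Pattern.
Variable m : nat.

Let V (j e : nat) : ladder m.+1 := (inord j, inord e).

Let adjV j e j' e' : j < m.+1 -> e < 2 -> j' < m.+1 -> e' < 2 ->
  ladj j e j' e' -> adj (V j e) (V j' e').
Proof.
move=> h1 h2 h3 h4; rewrite /= /cart_adj /= /path_adj /ladj -!val_eqE /= !inordK //.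
by lia.
Qed.

Let neqV j e j' e' : j < m.+1 -> e < 2 -> j' < m.+1 -> e' < 2 ->
  (j != j') || (e != e') -> V j e != V j' e'.
Proof.
by move=> h1 h2 h3 h4; rewrite /V xpair_eqE -!val_eqE /= !inordK // -negb_and.
Qed.

Let patternV j e : j < m.+1 -> e < 2 ->
  0 < pattern m.+1 (V j e) = pebbles m.+1 j e.
Proof. by move=> h1 h2; rewrite ffunE !inordK // lt0b. Qed.

Lemma solvable_pattern : solvable (pattern m.+1).
Proof.
move=> v; have [j [e [-> jm e2]]] : exists j e, [/\ v = V j e, j < m.+1 & e < 2].
  exists v.1, v.2; rewrite !ltn_ord; split=> //.
  by case: v => i d; rewrite /V !inord_val.
have [P|P] := boolP (pebbles m.+1 j e).
  by exists [::] => //=; rewrite patternV.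
rewrite /pebbles in P.
have [J|[J|J]] : j %% 3 = 0 \/ j %% 3 = 1 \/ j %% 3 = 2 by lia.
- apply: (@reachable_strict _ _ (V j 0) (V j.+1 1));
    (try by apply: neqV => //; lia); (try by apply: adjV => //; rewrite /ladj; lia);
    by rewrite patternV /pebbles; lia.
- apply: (@reachable_strict _ _ (V j 1) (V j.-1 0));
    (try by apply: neqV => //; lia); (try by apply: adjV => //; rewrite /ladj; lia);
    by rewrite patternV /pebbles; lia.
have [E|E] : e = 1 \/ e = 0 by lia.
(* [V j.+1 1] has a pebble if its column is last; otherwise [V j.+1 0] and [V j.+2 1] supply one. *)
- subst e; have [jm2|jm2] : j.+2 = m.+1 \/ j.+2 < m.+1 by lia.
  + apply: (@reachable_strict _ _ (V j.-1 1) (V j.+1 1));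
    (try by apply: neqV => //; lia); (try by apply: adjV => //; rewrite /ladj; lia);
    by rewrite patternV /pebbles; lia.
  + apply: (@reachable_strict2 _ _ (V j.+1 0) (V j.+2 1) (V j.+1 1) (V j.-1 1));
    (try by apply: neqV => //; lia); (try by apply: adjV => //; rewrite /ladj; lia);
    by rewrite patternV /pebbles; lia.
(* [V j.-1 0] is filled first; its partner is the extra pebble [V j 1] in the last column, else
   [V j.+1 0]. *)
- subst e; have [jm1|jm1] : j = m \/ j.+1 < m.+1 by lia.
  + apply: (@reachable_strict2 _ _ (V j.-1 1) (V j.-2 0) (V j.-1 0) (V j 1));
    (try by apply: neqV => //; lia); (try by apply: adjV => //; rewrite /ladj; lia);
    by rewrite patternV /pebbles; lia.
  + apply: (@reachable_strict2 _ _ (V j.-1 1) (V j.-2 0) (V j.-1 0) (V j.+1 0));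
    (try by apply: neqV => //; lia); (try by apply: adjV => //; rewrite /ladj; lia);
    by rewrite patternV /pebbles; lia.
Qed.

Lemma size_pattern : dist_size (pattern m.+1) = 2 * (m.+1 %/ 3) + 1 + (m.+1 %% 3 != 0).
Proof.
rewrite size_config_of.
have E j e : j < m.+1 -> e < 2 -> config_of _ (pattern m.+1) j e = pebbles m.+1 j e.
  move=> jm e2; rewrite /config_of (big_pred1 (V j e)); first by rewrite ffunE !inordK.
  by move=> [x y]; rewrite /= xpair_eqE -!val_eqE /= !inordK.
rewrite (eq_bigr (fun j : 'I_m.+1 => pebbles m.+1 j 0 + pebbles m.+1 j 1)); last first.
  by move=> j _; rewrite /col !E.
rewrite big_ord_recr /= (eq_bigr (fun j : 'I_m => (j %% 3 != 2) : nat)); last first.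
  by move=> [j jm] _; rewrite /pebbles /=; lia.
have -> : \sum_(j < m) (j %% 3 != 2) = 2 * (m %/ 3) + minn (m %% 3) 2.
  by elim: m => [|k IH]; rewrite ?big_ord0 // big_ord_recr /= IH; lia.
by rewrite /pebbles; lia.
Qed.

End Pattern.

Theorem theorem1 (n k r : nat) (hn : 1 <= n) (hk : k = n %/ 3) (hr : r < 3)
    (hnkr : n = 3 * k + r) :
  optimal_rubbling_number (ladder n) =
    match r with
    | 0 => 1 + 2 * k
    | 1 => 2 + 2 * k
    | _ => 2 + 2 * k
    end.
Proof.
have -> : match r with 0 => 1 + 2 * k | 1 => 2 + 2 * k | _ => 2 + 2 * k end
    = 2 * (n %/ 3) + 1 + (n %% 3 != 0).
  by case: r hr hnkr => [|[|[|//]]] _; lia.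
rewrite /optimal_rubbling_number; case: ex_minnP => s /asboolP[p S <-] min_p.
apply/eqP; rewrite eqn_leq; apply/andP; split.
  apply: min_p; apply/asboolP; exists (pattern n).
    by case: n hn {hk hnkr p S} => // m _; exact: solvable_pattern.
  by case: n hn {hk hnkr p S} => // m _; exact: size_pattern.
(* Rounding [(2 * n + 2) / 3] up gives the claimed value in each residue class. *)
by have := solvable_size_ge _ _ hn S; lia.
Qed.
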